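(* Let $w\in F$ be positive. For any rational $p/q$ the set of $(r,s)\in[0,1]\times[0,1]$ such that $R(w,r,s)\ge p/q$ is a finite sided rational polyhedron, whose boundary consists of finitely many horizontal or vertical segments.
   Context: $F$ is the free group on two generators $a,b$. A word in $F$ is positive if it contains only the letters $a$ and $b$, and no $a^{-1}$ or $b^{-1}$. $\mathrm{Homeo}^+(S^1)^\sim$ denotes the group of increasing homeomorphisms of $\mathbb{R}$ commuting with $x\mapsto x+1$ (lifts of orientation-preserving homeomorphisms of $S^1=\mathbb{R}/\mathbb{Z}$), and $\mathrm{rot}^\sim(\varphi)=\lim_{n\to\infty}(\varphi^n(x)-x)/n\in\mathbb{R}$ is the real-valued Poincaré rotation number. For $w\in F$ and $r,s\in\mathbb{R}$, $R(w,r,s)$ denotes the supremum of $\mathrm{rot}^\sim(\rho(w))$ over all homomorphisms $\rho:F\to \mathrm{Homeo}^+(S^1)^\sim$ with $\mathrm{rot}^\sim(\rho(a))=r$ and $\mathrm{rot}^\sim(\rho(b))=s$. A polyhedron here is a polygon in the plane (not necessarily convex); rational means that its vertices have rational coordinates. *)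

(* Defs.v *)
From HB Require Import structures.
From mathcomp Require Import all_boot all_order all_algebra.
From mathcomp Require Import all_classical all_reals all_analysis.

Set Implicit Arguments.
Unset Strict Implicit.
Unset Printing Implicit Defensive.

Import Order.TTheory GRing.Theory Num.Theory.
Import numFieldNormedType.Exports.

Local Open Scope classical_set_scope.
Local Open Scope ring_scope.

(* The free group on X, as reduced words. A letter (x, false) stands for x and
   (x, true) for its inverse. *)
Section FreeGroup.
Variable X : choiceType.
Implicit Types (l : X * bool) (s t u : seq (X * bool)).

Definition linv l : X * bool := (l.1, ~~ l.2).

Definition reduced s : bool := sorted (fun l m => m != linv l) s.

(* The reduced form of l :: s, for s reduced. *)
Definition push l s : seq (X * bool) :=
  if s is m :: s' then if m == linv l then s' else l :: s else [:: l].

Lemma linvK : involutive linv.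
Proof. by case=> x e; rewrite /linv /= negbK. Qed.

Lemma reduced_behead l s : reduced (l :: s) -> reduced s.
Proof. exact: path_sorted. Qed.

Lemma push_reduced l s : reduced s -> reduced (push l s).
Proof.
case: s => [//|m s] rs /=.
case: eqVneq => [_|ne]; first exact: reduced_behead rs.
by rewrite /reduced /= ne.
Qed.

Lemma push_cons l s : reduced (l :: s) -> push l s = l :: s.
Proof. by case: s => [//|m s] /= /andP[/negbTE ->]. Qed.

Lemma push_linvK l s : reduced s -> push l (push (linv l) s) = s.
Proof.
case: s => [_|m s rs] /=; first by rewrite eqxx.
rewrite linvK; case: eqVneq => [eml|_] /=; last by rewrite eqxx.
by rewrite -eml push_cons.
Qed.

Definition word_mul s t := foldr push t s.

Lemma word_mul_reduced s t : reduced t -> reduced (word_mul s t).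
Proof. by move=> rt; elim: s => //= l s; exact: push_reduced. Qed.

Lemma word_mul_push l s t :
  reduced t -> word_mul (push l s) t = push l (word_mul s t).
Proof.
move=> rt; case: s => [//|m s] /=; case: eqVneq => [->|//].
by rewrite push_linvK // word_mul_reduced.
Qed.

Lemma word_mulA s t u :
  reduced u -> word_mul s (word_mul t u) = word_mul (word_mul s t) u.
Proof. by move=> ru; elim: s => //= l s ->; rewrite word_mul_push. Qed.

Lemma word_mul1 s : reduced s -> word_mul s [::] = s.
Proof.
elim: s => //= l s IHs rs.
by rewrite IHs ?push_cons //; exact: reduced_behead rs.
Qed.

Definition word_inv s := rev (map linv s).

Lemma word_invK : involutive word_inv.
Proof. by move=> s; rewrite /word_inv map_rev revK mapK //; exact: linvK. Qed.

Lemma word_inv_reduced s : reduced s -> reduced (word_inv s).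
Proof.
rewrite /reduced /word_inv rev_sorted sorted_map; apply: sub_sorted => l m /=.
by rewrite linvK eq_sym.
Qed.

Lemma word_mulV s : word_mul (word_inv s) s = [::].
Proof.
elim: s => //= l s IHs.
rewrite /word_inv /= rev_cons /word_mul foldr_rcons /=.
by rewrite linvK eqxx.
Qed.

Record free_group := FreeGroup {
  word :> seq (X * bool);
  word_reduced : reduced word }.

HB.instance Definition _ := [isSub for word].
HB.instance Definition _ := [Choice of free_group by <:].

Implicit Types v w : free_group.

Definition fg_one := @FreeGroup [::] isT.
Definition fg_mul v w := FreeGroup (word_mul_reduced v (word_reduced w)).
Definition fg_inv w := FreeGroup (word_inv_reduced (word_reduced w)).

Lemma fg_mulA : associative fg_mul.
Proof. by move=> u v w; apply/val_inj/word_mulA/word_reduced. Qed.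
Lemma fg_mul1g : left_id fg_one fg_mul.
Proof. by move=> w; apply: val_inj. Qed.
Lemma fg_mulg1 : right_id fg_one fg_mul.
Proof. by move=> w; apply/val_inj/word_mul1/word_reduced. Qed.
Lemma fg_mulVg : left_inverse fg_one fg_inv fg_mul.
Proof. by move=> w; apply/val_inj/word_mulV. Qed.
Lemma fg_mulgV : right_inverse fg_one fg_inv fg_mul.
Proof.
by move=> w; apply: val_inj => /=; rewrite -{1}[word w]word_invK word_mulV.
Qed.

HB.instance Definition _ :=
  isGroup.Build free_group fg_mulA fg_mul1g fg_mulg1 fg_mulVg fg_mulgV.

Definition fg_gen (x : X) : free_group := @FreeGroup [:: (x, false)] isT.

Definition positive w : bool := all (fun l => ~~ l.2) (word w).

End FreeGroup.

Notation F2 := (free_group bool).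
Definition gen_a : F2 := fg_gen false.
Definition gen_b : F2 := fg_gen true.

(* The group Homeo^+(S^1)^~, with composition as product. *)
Section LiftGroup.
Variable R : realType.

Record homeo_lift := HomeoLift {
  lift_fun :> R -> R;
  lift_inv : R -> R;
  lift_funK : cancel lift_fun lift_inv;
  lift_invK : cancel lift_inv lift_fun;
  lift_continuous : continuous lift_fun;
  lift_inv_continuous : continuous lift_inv;
  lift_increasing : {homo lift_fun : x y / x < y};
  lift_add1 : forall x, lift_fun (x + 1) = lift_fun x + 1 }.

Implicit Types f g h : homeo_lift.

Lemma lift_eq f g : lift_fun f = lift_fun g -> f = g.
Proof.
case: f => f f' fK f'K cf cf' incf f1; case: g => g g' gK g'K cg cg' incg g1 /=.
move=> efg; rewrite -{}efg in gK g'K cg incg g1 *.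
have egf : g' = f' by apply/funext => x; rewrite -[x in LHS]f'K gK.
rewrite {}egf in gK g'K cg' *.
by congr HomeoLift; exact: Prop_irrelevance.
Qed.

HB.instance Definition _ := gen_eqMixin homeo_lift.
HB.instance Definition _ := gen_choiceMixin homeo_lift.

Definition lift_one : homeo_lift.
Proof. by exists id id => // x; exact: cvg_id. Defined.

Definition lift_mul f g : homeo_lift.
Proof.
exists (f \o g) (lift_inv g \o lift_inv f).
- exact: can_comp (lift_funK f) (lift_funK g).
- exact: can_comp (lift_invK g) (lift_invK f).
- by move=> x; apply: continuous_comp; exact: lift_continuous.
- by move=> x; apply: continuous_comp; exact: lift_inv_continuous.
- by move=> x y xy; do 2 apply: lift_increasing.
- by move=> x /=; rewrite !lift_add1.
Defined.

Definition lift_opp f : homeo_lift.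
Proof.
exists (lift_inv f) f.
- exact: lift_invK.
- exact: lift_funK.
- exact: lift_inv_continuous.
- exact: lift_continuous.
- move=> x y xy; rewrite ltNge le_eqVlt; apply/negP => /orP[/eqP e|].
    by move: xy; rewrite -(lift_invK f x) -(lift_invK f y) e ltxx.
  by move/(@lift_increasing f); rewrite !lift_invK ltNge (ltW xy).
- by move=> x; rewrite -{1}(lift_invK f x) -lift_add1 lift_funK.
Defined.

Lemma lift_mulA : associative lift_mul.
Proof. by move=> f g h; apply: lift_eq. Qed.
Lemma lift_mul1g : left_id lift_one lift_mul.
Proof. by move=> f; apply: lift_eq. Qed.
Lemma lift_mulg1 : right_id lift_one lift_mul.
Proof. by move=> f; apply: lift_eq. Qed.
Lemma lift_mulVg : left_inverse lift_one lift_opp lift_mul.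
Proof. by move=> f; apply/lift_eq/funext => x /=; rewrite lift_funK. Qed.
Lemma lift_mulgV : right_inverse lift_one lift_opp lift_mul.
Proof. by move=> f; apply/lift_eq/funext => x /=; rewrite lift_invK. Qed.

HB.instance Definition _ :=
  isGroup.Build homeo_lift lift_mulA lift_mul1g lift_mulg1 lift_mulVg lift_mulgV.

(* The limit exists and does not depend on the base point; we take x = 0. *)
Definition rot (f : homeo_lift) : R :=
  limn (fun n => (iter n f 0 - 0) / n%:R).

(* The set is nonempty (send a and b to the translations by r and s) and bounded,
   so [sup] is the genuine supremum. *)
Definition max_rot (w : F2) (r s : R) : R :=
  sup [set t | exists rho : {multiplicative F2 -> homeo_lift},
         [/\ rot (rho gen_a) = r, rot (rho gen_b) = s & t = rot (rho w)]].

End LiftGroup.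

Section Polygons.
Variable R : realType.

Definition convex_hull (P : seq (R * R)) : set (R * R) :=
  [set z | exists c : 'I_(size P) -> R,
     [/\ forall i, 0 <= c i,
         \sum_i c i = 1,
         z.1 = \sum_i c i * (tnth (in_tuple P) i).1
       & z.2 = \sum_i c i * (tnth (in_tuple P) i).2]].

Definition rat_point (p : rat * rat) : R * R := (ratr p.1, ratr p.2).

(* A not necessarily convex polygon is a finite union of convex ones; as for any
   polygon, the union must be connected and have no holes. Degenerate polygons
   are allowed, as they do occur: for w = ab, the set R(w, r, s) >= 2 consists
   of the two sides r = 1 and s = 1 of the square, and R(w, r, s) >= 4 is
   empty. *)
Definition rational_polygon (S : set (R * R)) : Prop :=
  [/\ exists Ps : seq (seq (rat * rat)),
        S = \bigcup_(P in [set` Ps]) convex_hull (map rat_point P),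
      connected S
    & connected (~` S)].

Definition boundary (S : set (R * R)) : set (R * R) := closure S `\` interior S.

Definition axis_parallel (e : (rat * rat) * (rat * rat)) : bool :=
  (e.1.1 == e.2.1) || (e.1.2 == e.2.2).

Definition rectilinear_boundary (S : set (R * R)) : Prop :=
  exists2 es : seq ((rat * rat) * (rat * rat)),
    all axis_parallel es &
    boundary S =
      \bigcup_(e in [set` es]) convex_hull [:: rat_point e.1; rat_point e.2].

End Polygons.

(* Main.v *)
Require Import Defs.
From HB Require Import structures.
From mathcomp Require Import all_boot all_order all_algebra.
From mathcomp Require Import all_classical all_reals all_analysis.
From mathcomp Require Import ring lra.

Set Implicit Arguments.
Unset Strict Implicit.
Unset Printing Implicit Defensive.

Import Order.TTheory GRing.Theory Num.Theory.
Import numFieldNormedType.Exports.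

Local Open Scope classical_set_scope.
Local Open Scope ring_scope.

Local Notation rot := Defs.rot.

(* If w(f, g)^q x >= x + p for some lifts f, g and some x, only the finitely many
   points of the orbit of x matter. Let X be this finite set plus Z, and round
   the values of f and g down to X: the orbit is unchanged, the rotation numbers
   do not increase, and they become rational with denominators at most the
   number of points of X mod Z. A small perturbation turns the rounded maps
   into homeomorphisms without changing their rotation numbers. Hence every
   (r, s) with R(w, r, s) >= p/q dominates a rational point with a bounded
   denominator having the same property; as R(w, ., .) is nondecreasing, the set
   is a finite union of boxes [u, 1] x [v, 1].

   The supremum R(w, r, s) need not be attained a priori, so one only has
   w(f, g)^q x >= x + p - t with t small. One conjugates f and g to be almost
   4-Lipschitz and replaces them by f + t and g + t: the Lipschitz bound makes the
   increase of the rotation numbers uniformly small, hence too small to reach a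
   new rational with a bounded denominator. *)

(** * Rotation numbers *)

(** Archimedean principle, used to discard errors that stay bounded along all iterates. *)
Lemma natmul_bounded_le0 (R : realType) (a C : R) :
  (forall k : nat, k%:R * a <= C) -> a <= 0.
Proof.
move=> H; rewrite leNgt; apply/negP => a0.
have := H (Num.truncn (C / a)).+1.
rewrite -ler_pdivlMr // leNgt.
by rewrite truncnS_gt.
Qed.

(** Monotonicity is weak, so as to include step functions such as the rounded maps. *)
Definition degree_one (R : realType) (F : R -> R) :=
  {homo F : x y / x <= y} /\ (forall x, F (x + 1) = F x + 1).

Section DegreeOne.
Context {R : realType}.
Implicit Types (F G : R -> R) (x y : R).

Lemma degree_one_nat F x (k : nat) :
  degree_one F -> F (x + k%:R) = F x + k%:R.
Proof.
move=> [_ F1]; elim: k => [|k IH]; first by rewrite !addr0.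
by rewrite -natr1 !addrA F1 IH.
Qed.

Lemma degree_one_int F x (l : int) :
  degree_one F -> F (x + l%:~R) = F x + l%:~R.
Proof.
move=> dF; case: l => k; first exact: degree_one_nat.
rewrite NegzE mulrNz; apply: (addIr k.+1%:R).
by rewrite -(degree_one_nat _ k.+1 dF) !subrK.
Qed.

Lemma degree_one_comp F G :
  degree_one F -> degree_one G -> degree_one (F \o G).
Proof.
move=> [Fm F1] [Gm G1]; split=> [x y xy|x] /=; first by apply/Fm/Gm.
by rewrite G1 F1.
Qed.

Lemma degree_one_iter F n : degree_one F -> degree_one (iter n F).
Proof.
move=> dF; elim: n => [|n IH]; first by split.
exact: (degree_one_comp dF IH).
Qed.

(** With k the floor of x - y, one has F x <= F (y + k + 1) = F y + k + 1 and k <= x - y. *)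
Lemma degree_one_displacement F x y :
  degree_one F -> F x - x <= F y - y + 1.
Proof.
move=> dF; have [Fm F1] := dF.
set k := Num.floor (x - y).
have /andP[k1 k2] := floor_itv (x - y).
have : F x <= F (y + (k + 1)%:~R) by apply: Fm; move: k2; rewrite -/k; lra.
rewrite degree_one_int // intrD; move: k1; rewrite -/k; lra.
Qed.

Lemma degree_one_near_id F x : degree_one F ->
  `|F x - x| <= `|F 0| + 1.
Proof.
move=> dF.
have := degree_one_displacement x 0 dF.
have := degree_one_displacement 0 x dF.
have := ler_norm (F 0); have := ler_norm (- F 0); rewrite normrN !subr0 => *.
by rewrite ler_norml; apply/andP; split; lra.
Qed.

(** Each of the k blocks of n steps gains at least the displacement at x minus 1. *)
Lemma iter_lower F x (k n : nat) : degree_one F ->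
  k%:R * (iter n F x - x - 1) <= iter (k * n) F x - x.
Proof.
move=> dF; elim: k => [|k IH]; first by rewrite mul0r mul0n subrr.
rewrite mulSn iterD -natr1.
have := degree_one_displacement x (iter (k * n) F x) (degree_one_iter n dF).
move: IH; set a := iter (k * n) F x; lra.
Qed.

Lemma iter_upper F x (k n : nat) : degree_one F ->
  iter (k * n) F x - x <= k%:R * (iter n F x - x + 1).
Proof.
move=> dF; elim: k => [|k IH]; first by rewrite mul0r mul0n subrr.
rewrite mulSn iterD -natr1.
have := degree_one_displacement (iter (k * n) F x) x (degree_one_iter n dF).
move: IH; set a := iter (k * n) F x; lra.
Qed.

(** No error accumulates, because F commutes with the integer translation by [l]. *)
Lemma iter_ge_int F x (k m : nat) (l : int) : degree_one F ->
  x + l%:~R <= iter m F x -> x + k%:R * l%:~R <= iter (k * m) F x.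
Proof.
move=> dF H; elim: k => [|k IH]; first by rewrite mul0r addr0 mul0n.
have /(degree_one_iter m)[Im _] := dF.
rewrite mulSn iterD; apply: le_trans (Im _ _ IH).
have := degree_one_int x (k%:Z * l) (degree_one_iter m dF).
rewrite intrM => ->; move: H; rewrite -natr1 -pmulrn; lra.
Qed.

Lemma iter_le_int F x (k m : nat) (l : int) : degree_one F ->
  iter m F x <= x + l%:~R -> iter (k * m) F x <= x + k%:R * l%:~R.
Proof.
move=> dF H; elim: k => [|k IH]; first by rewrite mul0r addr0 mul0n.
have /(degree_one_iter m)[Im _] := dF.
rewrite mulSn iterD; apply: le_trans (Im _ _ IH) _.
have := degree_one_int x (k%:Z * l) (degree_one_iter m dF).
rewrite intrM => ->; move: H; rewrite -natr1 -pmulrn; lra.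
Qed.

Lemma iter_homo_le F G n x : {homo G : x y / x <= y} -> (forall y, F y <= G y) ->
  iter n F x <= iter n G x.
Proof.
by move=> Gm FG; elim: n => //= n IH; apply: le_trans (FG _) (Gm _ _ IH).
Qed.

End DegreeOne.

Section RotationNumber.
Context {R : realType}.
Implicit Types (f g : homeo_lift R) (x y : R).

Lemma lift_degree_one f : degree_one f.
Proof.
split; last exact: lift_add1.
move=> x y; rewrite le_eqVlt => /predU1P[->//|xy].
exact/ltW/lift_increasing.
Qed.

(** Computing the iterate of order m k in two ways shows that the intervals
    [(f^n 0 - 1) / n, (f^n 0 + 1) / n] meet pairwise. The supremum of their left ends lies in all of
    them and, as their lengths tend to 0, it is the limit. *)
Lemma rot_bound0 f (n : nat) :
  iter n f 0 - 1 <= n%:R * rot f <= iter n f 0 + 1.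
Proof.
have df := lift_degree_one f.
have key (m k : nat) : (0 < m)%N -> (0 < k)%N ->
    (iter m f 0 - 1) / m%:R <= (iter k f 0 + 1) / k%:R.
  move=> m0 k0.
  rewrite ler_pdivrMr ?ltr0n // mulrAC ler_pdivlMr ?ltr0n //.
  have := iter_lower 0 k m df; have := iter_upper 0 m k df.
  rewrite mulnC !subr0 => h1 h2; have := le_trans h2 h1.
  by rewrite mulrC [X in _ <= X]mulrC.
pose A := [set (iter m.+1 f 0 - 1) / m.+1%:R | m in [set: nat]].
have Aub k : ubound A ((iter k.+1 f 0 + 1) / k.+1%:R).
  by move=> _ [m _ <-]; exact: key.
have A0 : A !=set0 by exists ((iter 1 f 0 - 1) / 1%:R); exists 0%N.
have hA : has_sup A by split=> //; exists ((iter 1 f 0 + 1) / 1); exact: (Aub 0%N).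
have bL k : iter k.+1 f 0 - 1 <= k.+1%:R * sup A <= iter k.+1 f 0 + 1.
  apply/andP; split.
    rewrite mulrC -ler_pdivrMr ?ltr0n //; apply: ub_le_sup; first by case: hA.
    by exists k.
  rewrite mulrC -ler_pdivlMr ?ltr0n //; apply: ge_sup => //; exact: Aub.
suff -> : rot f = sup A by case: n => [|n]; [rewrite mul0r /= sub0r add0r lerN10 ler01|].
apply/cvg_lim => //.
apply/cvgrPdist_le => e e0; near=> k.
have n0 : (0 < k)%N by near: k; exists 1%N.
have ne : k%:R^-1 <= e :> R.
  have : e^-1 <= k%:R by near: k; exact: nbhs_infty_ger.
  by rewrite -[X in _ -> _ <= X]invrK lef_pV2 ?posrE ?invr_gt0 ?ltr0n.
apply: le_trans ne.
have nR : 0 < k%:R :> R by rewrite ltr0n.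
rewrite subr0 -(@ler_pM2r _ k%:R) // mulVf ?gt_eqF //.
rewrite -[X in _ * X]gtr0_norm // -normrM mulrBl divfK ?gt_eqF //.
have := bL k.-1; rewrite prednK // mulrC => /andP[h1 h2].
by rewrite ler_norml; apply/andP; split; lra.
Unshelve. all: by end_near.
Qed.

Lemma rot_bound f (n : nat) x :
  iter n f x - x - 2 <= n%:R * rot f <= iter n f x - x + 2.
Proof.
have /andP[h1 h2] := rot_bound0 f n.
have dn := degree_one_iter n (lift_degree_one f).
have h3 := degree_one_displacement x 0 dn.
have h4 := degree_one_displacement 0 x dn.
by apply/andP; split; lra.
Qed.

(** The integer gain repeats exactly along the iterates, so the bounded error of [rot_bound] becomes
    negligible. *)
Lemma le_rot f (m : nat) (l : int) x :
  x + l%:~R <= iter m f x -> l%:~R <= m%:R * rot f.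
Proof.
move=> H; rewrite -subr_le0; apply: (@natmul_bounded_le0 _ _ 2) => k.
have := iter_ge_int k (lift_degree_one f) H.
have /andP[h _] := rot_bound f (k * m) x.
move: h; rewrite natrM; lra.
Qed.

Lemma rot_le f (m : nat) (l : int) x :
  iter m f x <= x + l%:~R -> m%:R * rot f <= l%:~R.
Proof.
move=> H; rewrite -subr_le0; apply: (@natmul_bounded_le0 _ _ 2) => k.
have := iter_le_int k (lift_degree_one f) H.
have /andP[_ h] := rot_bound f (k * m) x.
move: h; rewrite natrM; lra.
Qed.

(** Otherwise every block of m steps along the orbit of 0 gains at most t, which bounds the rotation
    number. *)
Lemma lt_rot_iter f (m : nat) (t : R) :
  t < m%:R * rot f -> exists x, x + t < iter m f x.
Proof.
move=> H; apply: contrapT => /forallNP N.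
suff : m%:R * rot f <= t by rewrite leNgt H.
have Q x : iter m f x <= x + t by rewrite leNgt; apply/negP/N.
rewrite -subr_le0; apply: (@natmul_bounded_le0 _ _ 2) => k.
have : iter (k * m) f 0 <= k%:R * t.
  elim: k => [|k IH]; first by rewrite mul0r mul0n.
  by rewrite mulSn iterD -natr1; apply: le_trans (Q _) _; lra.
have /andP[_ h] := rot_bound f (k * m) 0.
move: h; rewrite natrM; lra.
Qed.

(* Conjugation moves every point of an orbit by a bounded amount. *)
Lemma rot_conj f g : rot (g * f * g^-1)%g = rot f.
Proof.
set h := (g * f * g^-1)%g.
have hK n y : iter n h (g y) = g (iter n f y).
  elim: n => //= n ->.
  by change (g (f (lift_inv g (g (iter n f y)))) = g (f (iter n f y))); rewrite lift_funK.
have gC x := degree_one_near_id x (lift_degree_one g); set a := `|g 0| + 1 in gC.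
apply/eqP; rewrite eq_le -[X in X && _]subr_le0 -[X in _ && X]subr_le0.
apply/andP; split; apply: (@natmul_bounded_le0 _ _ (2 * a + 4)) => n;
  have := rot_bound h n (g 0); have := rot_bound f n 0;
  rewrite hK; have := gC 0; have := gC (iter n f 0); rewrite !ler_norml;
  set F := iter n f 0; set G := g F;
  by move=> /andP[? ?] /andP[? ?] /andP[? ?] /andP[? ?]; lra.
Qed.

Lemma rot_mono f g : (forall x, f x <= g x) -> rot f <= rot g.
Proof.
move=> fg; rewrite -subr_le0; apply: (@natmul_bounded_le0 _ _ 2) => n.
have /andP[_ h1] := rot_bound0 f n; have /andP[h2 _] := rot_bound0 g n.
have := iter_homo_le n 0 (lift_degree_one g).1 fg.
move: h1 h2; lra.
Qed.

End RotationNumber.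

(** * Approximation of degree one maps by homeomorphisms *)

Section Realization.
Context {R : realType}.
Implicit Types (f g : homeo_lift R) (x y : R).

(** F stays within bounded distance of the identity, so it is onto by the intermediate value
    theorem; its inverse is continuous by monotonicity. *)
Lemma degree_one_lift (F : R -> R) :
  {homo F : x y / x < y} -> continuous F -> (forall x, F (x + 1) = F x + 1) ->
  exists f, lift_fun f = F.
Proof.
move=> Fi Fc F1.
have dF : degree_one F.
  by split=> // x y; rewrite le_eqVlt => /predU1P[->//|xy]; exact/ltW/Fi.
have surj y : exists x, F x = y.
  pose C := `|F 0| + 1.
  have C0 : 0 <= C by rewrite addr_ge0.
  have := degree_one_near_id (y - C) dF; have := degree_one_near_id (y + C) dF.
  rewrite -/C !ler_norml => /andP[h1 h2] /andP[h3 h4].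
  have ab : y - C <= y + C by lra.
  have [||x _ <-] := @IVT R F _ _ y ab; last by exists x.
    exact: continuous_subspaceT.
  by rewrite ge_min le_max; apply/andP; split; apply/orP; [left|right]; lra.
pose G y := projT1 (cid (surj y)).
have GK : cancel G F by move=> y; exact: projT2 (cid (surj y)).
have Fm : {mono F : x y / x < y} by apply: leW_mono; exact: le_mono.
have FK : cancel F G.
  by move=> x; apply: (inc_inj (le_mono Fi)); rewrite GK.
have Gc : continuous G.
  move=> y; apply/cvgrPdist_lt => e e0; near=> z.
  have h1 : F (G y - e) < z.
    by near: z; apply: lt_nbhsr; rewrite -[X in _ < X]GK Fm; lra.
  have h2 : z < F (G y + e).
    by near: z; apply: lt_nbhsl; rewrite -[X in X < _]GK Fm; lra.
  move: h1 h2; rewrite -(GK z) !Fm FK => h1 h2.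
  by rewrite ltr_norml; apply/andP; split; lra.
by exists (HomeoLift FK GK Fc Gc Fi F1).
Unshelve. all: by end_near.
Qed.

(* The sup-convolution of [F] with a steep slope is Lipschitz; mixing in a small
   multiple of the identity makes it strictly increasing. *)
Lemma lift_between (F : R -> R) (e : R) : degree_one F -> 0 < e ->
  exists f, forall x, F x <= f x <= F (x + e) + e.
Proof.
move=> dF e0; have [Fm F1] := dF.
(* With this slope no y > x + e matters in the supremum: there F y - F x <= (y - x) + 1 <= L (y -
   x). *)
pose L := 1 + e^-1; have ei0 : 0 < e^-1 by rewrite invr_gt0.
have L0 : 0 < L by rewrite /L; lra.
pose A x := [set F y - L * Num.max 0 (y - x) | y in [set: R]].
have A0 x : A x !=set0 by exists (F x - L * Num.max 0 (x - x)); exists x.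
have Aub x : ubound (A x) (F (x + e)).
  move=> _ [y _ <-]; have [yx|xy] := leP y (x + e).
    have := Fm _ _ yx; suff : 0 <= L * Num.max 0 (y - x) by lra.
    by rewrite mulr_ge0 ?(ltW L0)// le_max lexx.
  have := degree_one_displacement y x dF; have := Fm x (x + e).
  have -> : Num.max 0 (y - x) = y - x by apply/max_idPr; lra.
  have : 1 <= e^-1 * (y - x) by rewrite mulrC ler_pdivlMr //; lra.
  by rewrite /L mulrDl mul1r => ? /(_ _)-/(_ ltac:(lra)); lra.
have hA x : has_sup (A x) by split=> //; exists (F (x + e)); exact: Aub.
pose c x := sup (A x).
have cge x y : F y - L * Num.max 0 (y - x) <= c x.
  by apply: ub_le_sup; [case: (hA x)|exists y].
have cle x M : (forall y, F y - L * Num.max 0 (y - x) <= M) -> c x <= M.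
  by move=> H; apply: ge_sup => // _ [y _ <-].
have cF x : F x <= c x.
  by have := cge x x; rewrite subrr maxxx mulr0 subr0.
have cFe x : c x <= F (x + e) by apply: ge_sup => //; exact: Aub.
have cm : {homo c : x y / x <= y}.
  move=> x x' xx'; apply: cle => y; apply: le_trans (cge _ y).
  rewrite lerD2l lerN2 ler_pM2l // ge_max le_max lexx /= le_max.
  by apply/orP; right; lra.
have c1 x : c (x + 1) = c x + 1.
  apply/eqP; rewrite eq_le; apply/andP; split.
    apply: cle => y; have := cge x (y - 1); have := F1 (y - 1).
    by rewrite subrK (_ : y - 1 - x = y - (x + 1)); [lra|ring].
  suff : c x <= c (x + 1) - 1 by lra.
  apply: cle => y; have := cge (x + 1) (y + 1).
  by rewrite F1 (_ : y + 1 - (x + 1) = y - x); [lra|ring].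
have clip x x' : x <= x' -> c x' <= c x + L * (x' - x).
  move=> xx'; apply: cle => y; have := cge x y.
  have : Num.max 0 (y - x) <= Num.max 0 (y - x') + (x' - x).
    rewrite ge_max; apply/andP; split.
      by rewrite addr_ge0 ?le_max ?lexx// subr_ge0.
    by rewrite -lerBlDr le_max; apply/orP; right; lra.
  by rewrite -(ler_pM2l L0); lra.
have cc : continuous c.
  move=> x; apply/cvgrPdist_le => d d0; near=> y.
  have : `|x - y| <= d / L.
    by near: y; apply: cvgr_dist_le; [exact: cvg_id|rewrite divr_gt0].
  rewrite ler_pdivlMr // => h.
  have [xy|yx] := leP x y.
    have := clip _ _ xy; have := cm _ _ xy; move: h.
    rewrite ler0_norm ?subr_le0 // => *.
    by rewrite ler_norml; apply/andP; split; lra.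
  have := clip _ _ (ltW yx); have := cm _ _ (ltW yx); move: h.
  rewrite ger0_norm ?subr_ge0 ?(ltW yx) // => *.
  by rewrite ler_norml; apply/andP; split; lra.
pose K := `|c 0| + 1.
have K0 : 0 <= K by rewrite addr_ge0.
have cK x : `|c x - x| <= K by apply: degree_one_near_id.
(* Weight of the identity in the mixture. As [c] is within [K] of the identity, adding [t * K] keeps
   the mixture between c and c + 2 t K, and 2 t K <= e. *)
pose t := e / (2 * K + e + 1).
have D0 : 0 < 2 * K + e + 1 by lra.
have t0 : 0 < t by rewrite divr_gt0.
have tE : t * (2 * K + e + 1) = e by rewrite /t divfK // gt_eqF.
have t1 : t < 1 by rewrite /t ltr_pdivrMr //; lra.
have tK : t * (2 * K) <= e by rewrite -[X in _ <= X]tE ler_pM2l //; lra.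
have [|||f fE] := @degree_one_lift (fun x => (1 - t) * c x + t * x + t * K).
- move=> x y xy; have := cm _ _ (ltW xy).
  rewrite -(@ler_pM2l _ (1 - t)) ?subr_gt0 // -(ltr_pM2l t0) in xy *; lra.
- move=> x; apply: cvgD; last exact: cvg_cst.
  apply: cvgD; first by apply: cvgM; [exact: cvg_cst|exact: cc].
  by apply: cvgM; [exact: cvg_cst|exact: cvg_id].
- by move=> x; rewrite c1; ring.
exists f => x; rewrite fE.
have := cK x; rewrite ler_norml -(ler_pM2l t0) -[X in _ && X](ler_pM2l t0).
move=> /andP[h1 h2]; have := cF x; have := cFe x.
by move=> ? ?; apply/andP; split; lra.
Unshelve. all: by end_near.
Qed.

Lemma translation_subproof (t : R) : exists f, lift_fun f = (fun x => x + t).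
Proof.
apply: degree_one_lift => [x y|x|x]; first by rewrite ltrD2r.
  by apply: cvgD; [exact: cvg_id|exact: cvg_cst].
by rewrite addrAC.
Qed.

Definition translation t : homeo_lift R := projT1 (cid (translation_subproof t)).

Lemma translationE t x : translation t x = x + t.
Proof. by rewrite /translation; case: cid => /= f ->. Qed.

Lemma lift_mulE f g x : (f * g)%g x = f (g x). Proof. by []. Qed.

Lemma rot_translation t : rot (translation t) = t.
Proof.
have E n : iter n (translation t) 0 = n%:R * t.
  elim: n => [|n IH]; first by rewrite mul0r.
  by rewrite iterS IH translationE -natr1; ring.
apply/eqP; rewrite eq_le -[X in X && _]subr_le0 -[X in _ && X]subr_le0.
by apply/andP; split; apply: (@natmul_bounded_le0 _ _ 1) => n;
  have := rot_bound0 (translation t) n; rewrite E => /andP[? ?]; lra.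
Qed.

(** The rotation number is within 1/n of the n-th iterate of 0 divided by n, which is continuous in
    t: a uniform limit of continuous functions. *)
Lemma rot_shift_continuous f : continuous (fun t => rot (translation t * f)%g).
Proof.
have itc n : continuous (fun t => iter n (translation t * f)%g 0).
  elim: n => [|n IH] t; first exact: cvg_cst.
  rewrite (_ : (fun u => _) = (fun u => f (iter n (translation u * f)%g 0) + u)).
    apply: cvgD; last exact: cvg_id.
    by apply: (cvg_comp _ _ (IH t)); exact: lift_continuous.
  by apply/funext => u /=; rewrite translationE.
move=> t; apply/cvgrPdist_le => e e0.
pose n := (Num.truncn (3 / e)).+1.
have n0 : 0 < n%:R :> R by rewrite ltr0n.
have ne : 3 < n%:R * e by rewrite -ltr_pdivrMr // truncnS_gt.
near=> u.
have : `|iter n (translation t * f)%g 0 - iter n (translation u * f)%g 0| <= 1.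
  by near: u; apply: cvgr_dist_le; [exact: itc|].
have /andP[h1 h2] := rot_bound0 (translation t * f)%g n.
have /andP[h3 h4] := rot_bound0 (translation u * f)%g n.
rewrite ler_norml => /andP[h5 h6].
rewrite -(ler_pM2l n0) -{1}(gtr0_norm n0) -normrM ler_norml.
by apply/andP; split; lra.
Unshelve. all: by end_near.
Qed.

(** Intermediate value theorem for the rotation number of f followed by a translation, from
    translation 0 to one large enough to reach r. *)
Lemma exists_rot_ge f r : rot f <= r ->
  exists g, (forall x, f x <= g x) /\ rot g = r.
Proof.
move=> fr.
have E0 : (translation 0 * f)%g = f.
  by apply/lift_eq/funext => x; rewrite lift_mulE translationE addr0.
pose b := `|r| + `|f 0| + 1.
have b0 : 0 <= b by rewrite !addr_ge0.
have rb : r <= rot (translation b * f)%g.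
  have /andP[h _] := rot_bound0 (translation b * f)%g 1.
  move: h; rewrite mul1r /= translationE /b.
  have := ler_norm r; have := ler_norm (- f 0); rewrite normrN; lra.
have [||t] := @IVT R (fun t => rot (translation t * f)%g) 0 b r b0.
- by apply: continuous_subspaceT; exact: rot_shift_continuous.
- by rewrite E0 ge_min le_max fr rb orbT.
rewrite in_itv /= => /andP[t0 _] tr; exists (translation t * f)%g; split=> // x.
by rewrite lift_mulE translationE lerDl.
Qed.

End Realization.

(** * Positive words *)

Section Words.
Context {R : realType}.
Implicit Types (F G : R -> R) (f g h : homeo_lift R) (s : seq bool).

(** Defined for arbitrary maps, since it is also applied to rounded maps, which are not
    homeomorphisms. The rightmost letter acts first. *)
Definition eval_word F G s x := foldr (fun l y => if l then G y else F y) x s.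

Definition eval_lift f g s : homeo_lift R :=
  foldr (fun l h => (if l then g else f) * h)%g 1%g s.

Lemma eval_liftE f g s x : eval_lift f g s x = eval_word f g s x.
Proof. by elim: s => //= l s <-; case: l. Qed.

Lemma eval_word_flatten F G s q x :
  eval_word F G (flatten (nseq q s)) x = iter q (eval_word F G s) x.
Proof.
by elim: q => //= q <-; exact: foldr_cat.
Qed.

Lemma eval_word_le F G F' G' s x : degree_one F' -> degree_one G' ->
  (forall y, F y <= F' y) -> (forall y, G y <= G' y) ->
  eval_word F G s x <= eval_word F' G' s x.
Proof.
move=> [Fm _] [Gm _] FF GG; elim: s => //= l s IH.
case: l; first exact: le_trans (GG _) (Gm _ _ IH).
exact: le_trans (FF _) (Fm _ _ IH).
Qed.

Lemma eval_lift_conj f g h s :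
  eval_lift (h * f * h^-1)%g (h * g * h^-1)%g s = (h * eval_lift f g s * h^-1)%g.
Proof.
elim: s => [|l s IH] /=; first by rewrite mulg1 mulgV.
by rewrite IH; case: l; rewrite !mulgA mulgVK.
Qed.

(** Each letter raises a point by at most its rotation number plus 2; this makes the supremum in
    [max_rot] finite. *)
Lemma eval_lift_rot_le f g s :
  rot (eval_lift f g s) <= (size s)%:R * (`|rot f| + `|rot g| + 2).
Proof.
set C := _ + 2.
have bf x : f x <= x + C.
  have /andP[h _] := rot_bound f 1 x; move: h; rewrite mul1r /C /=.
  have := ler_norm (rot f); have := normr_ge0 (rot g); lra.
have bg x : g x <= x + C.
  have /andP[h _] := rot_bound g 1 x; move: h; rewrite mul1r /C /=.
  have := ler_norm (rot g); have := normr_ge0 (rot f); lra.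
rewrite leNgt; apply/negP => lt_rot.
have [|x] := @lt_rot_iter _ (eval_lift f g s) 1 ((size s)%:R * C).
  by rewrite mul1r.
rewrite [iter _ _ _]eval_liftE ltNge => /negP; apply.
elim: s {lt_rot} => [|l s IH] /=; first by rewrite mul0r addr0.
rewrite -natr1; case: l; first by have := bg (eval_word f g s x); lra.
by have := bf (eval_word f g s x); lra.
Qed.

Definition letter f g (l : bool * bool) : homeo_lift R :=
  let h := if l.1 then g else f in if l.2 then h^-1%g else h.

Definition free_hom f g (w : F2) : homeo_lift R :=
  foldr (fun l h => letter f g l * h)%g 1%g (word w).

(** Universal property of the free group: [push] prepends a letter or cancels it, and both agree
    with composition. *)
Lemma free_hom_morph f g : {morph free_hom f g : v w / (v * w)%g}.
Proof.
pose P (s : seq (bool * bool)) := foldr (fun l h => letter f g l * h)%g 1%g s.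
have letterV l : letter f g (linv l) = (letter f g l)^-1%g.
  by case: l => [x []]; rewrite /letter /= ?invgK.
have Ppush l (s : seq (bool * bool)) : P (push l s) = (letter f g l * P s)%g.
  case: s => //= m s; case: eqVneq => [->|//] /=.
  by rewrite letterV mulgA mulgV mul1g.
move=> v w; rewrite /free_hom /= -/(P _) -/(P (word v)) -/(P (word w)).
rewrite /word_mul; elim: (word v) => [|l s IH] /=; first by rewrite mul1g.
by rewrite Ppush IH mulgA.
Qed.

HB.instance Definition _ f g :=
  isMultiplicative.Build F2 (homeo_lift R) (free_hom f g) (@free_hom_morph f g).

Definition letters (w : F2) : seq bool := map fst (word w).

Lemma hom_positive (rho : {multiplicative F2 -> homeo_lift R}) (w : F2) :
  positive w -> rho w = eval_lift (rho gen_a) (rho gen_b) (letters w).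
Proof.
rewrite /positive /letters; case: w => s; elim: s => [|[l e] s IH] rs /=.
  have -> : FreeGroup rs = 1%g :> F2 by apply: val_inj.
  by move=> _; apply: (mulgI (rho 1%g)); rewrite -gmulfM !mulg1.
case/andP=> /= e0 ps; have {e0} e0 : e = false by case: e e0 {rs}.
subst e; have rs' := reduced_behead rs.
rewrite -(IH rs' ps) (_ : FreeGroup rs = (fg_gen l * FreeGroup rs')%g).
  by rewrite gmulfM; case: l {rs}.
by apply: val_inj => /=; rewrite -(push_cons rs).
Qed.

Lemma has_sup_max_rot (w : F2) (r s : R) : positive w ->
  has_sup [set t | exists rho : {multiplicative F2 -> homeo_lift R},
    [/\ rot (rho gen_a) = r, rot (rho gen_b) = s & t = rot (rho w)]].
Proof.
move=> pw; split.
  pose rho : {multiplicative F2 -> homeo_lift R} :=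
    free_hom (translation r) (translation s).
  exists (rot (rho w)), rho; split=> //=.
    by rewrite /free_hom /= mulg1 rot_translation.
  by rewrite /free_hom /= mulg1 rot_translation.
exists ((size (letters w))%:R * (`|r| + `|s| + 2)) => _ [rho [<- <- ->]].
by rewrite hom_positive // eval_lift_rot_le.
Qed.

Lemma rot_le_max_rot (w : F2) f g : positive w ->
  rot (eval_lift f g (letters w)) <= max_rot w (rot f) (rot g).
Proof.
move=> pw; apply: ub_le_sup; first by case: (has_sup_max_rot (rot f) (rot g) pw).
pose rho : {multiplicative F2 -> homeo_lift R} := free_hom f g.
have ra : rho gen_a = f by rewrite /= /free_hom /= mulg1.
have rb : rho gen_b = g by rewrite /= /free_hom /= mulg1.
rewrite /=; exists rho; split; rewrite ?ra ?rb //.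
by rewrite hom_positive // ra rb.
Qed.

Lemma lt_max_rot (w : F2) (r s t : R) : positive w -> t < max_rot w r s ->
  exists f g, [/\ rot f = r, rot g = s & t < rot (eval_lift f g (letters w))].
Proof.
move=> pw tw.
have e0 : 0 < max_rot w r s - t by rewrite subr_gt0.
have [_ [rho [ra rb ->]]] := sup_adherent e0 (has_sup_max_rot r s pw).
rewrite -/(max_rot w r s) subKr => h; exists (rho gen_a), (rho gen_b); split=> //.
by rewrite -hom_positive.
Qed.

(** Lifts f and g can be enlarged pointwise to have rotation numbers r' and s'; a positive word,
    having no inverses, then increases pointwise too. *)
Lemma max_rot_le (w : F2) (r s r' s' : R) : positive w -> r <= r' -> s <= s' ->
  max_rot w r s <= max_rot w r' s'.
Proof.
move=> pw rr ss; rewrite leNgt; apply/negP => /(lt_max_rot pw)[f [g [fr gs]]].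
rewrite ltNge => /negP; apply.
rewrite -fr in rr; rewrite -gs in ss.
have [f' [ff' <-]] := exists_rot_ge rr; have [g' [gg' <-]] := exists_rot_ge ss.
apply: le_trans (rot_le_max_rot _ _ pw); apply: rot_mono => x.
by rewrite !eval_liftE; apply: eval_word_le => //; exact: lift_degree_one.
Qed.

End Words.

(** * Rounding to a finite orbit *)

Section Rounding.
Context {R : realType}.
Implicit Types (f g : homeo_lift R) (X : seq R) (x y : R).

Definition round1 y x : R := y + (Num.floor (x - y))%:~R.

Lemma round1_degree_one y : degree_one (round1 y).
Proof.
split=> [x x' xx'|x]; rewrite /round1.
  by rewrite lerD2l ler_int; apply: le_floor; rewrite lerD2r.
by rewrite addrAC floorDrz ?floor1 ?intrD ?addrA // int_num1.
Qed.

Lemma round1_le y x : round1 y x <= x.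
Proof. by rewrite /round1; have := floor_le (x - y); lra. Qed.

Lemma round1_id y (k : int) : round1 y (y + k%:~R) = y + k%:~R.
Proof. by rewrite /round1 addrAC subrr add0r intrKfloor. Qed.

(* The largest element of [(x0 :: X) + Z] below [x]. *)
Definition round_down x0 X x : R :=
  foldr (fun y m => Num.max (round1 y x) m) (round1 x0 x) X.

Lemma round_down_leP x0 X x M :
  (forall y, y \in x0 :: X -> round1 y x <= M) -> round_down x0 X x <= M.
Proof.
elim: X => [|y X IH] H /=; first by apply: H; rewrite inE eqxx.
rewrite ge_max H ?inE ?eqxx ?orbT //= IH // => z; rewrite inE => /orP[/eqP->|zX].
  by apply: H; rewrite inE eqxx.
by apply: H; rewrite !inE zX !orbT.
Qed.

Lemma round1_le_round_down x0 X x y :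
  y \in x0 :: X -> round1 y x <= round_down x0 X x.
Proof.
elim: X => [|z X IH] /=; first by rewrite inE => /eqP->.
rewrite !inE orbCA le_max => /orP[/eqP->|h]; first by rewrite lexx.
by rewrite IH ?inE // orbT.
Qed.

Lemma round_down_mem x0 X x :
  exists y (k : int), y \in x0 :: X /\ round_down x0 X x = y + k%:~R.
Proof.
elim: X => [|z X [y [k [yX E]]]] /=.
  by exists x0, (Num.floor (x - x0)); rewrite inE eqxx.
have [_|_] := leP (round1 z x) (round_down x0 X x).
  exists y, k; split=> //; move: yX; rewrite !inE => /orP[->//|->].
  by rewrite !orbT.
by exists z, (Num.floor (x - z)); rewrite !inE eqxx orbT.
Qed.

Lemma round_down_le x0 X x : round_down x0 X x <= x.
Proof. by apply: round_down_leP => y _; exact: round1_le. Qed.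

Lemma round_down_degree_one x0 X : degree_one (round_down x0 X).
Proof.
split=> [x x' xx'|x].
  apply: round_down_leP => y yX; apply: le_trans (round1_le_round_down x' yX).
  exact: (round1_degree_one y).1.
elim: X => [|z X IH] /=; first exact: (round1_degree_one x0).2.
by rewrite IH (round1_degree_one z).2 addr_maxl.
Qed.

Lemma round_down_id x0 X y (k : int) :
  y \in x0 :: X -> round_down x0 X (y + k%:~R) = y + k%:~R.
Proof.
move=> yX; apply/eqP; rewrite eq_le round_down_le /=.
by rewrite -{1}(round1_id y k) round1_le_round_down.
Qed.

Lemma round_downK x0 X x :
  round_down x0 X (round_down x0 X x) = round_down x0 X x.
Proof. by have [y [k [yX ->]]] := round_down_mem x0 X x; exact: round_down_id. Qed.

Lemma exists_pos_lt X : (forall y, y \in X -> 0 < y) ->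
  exists2 e : R, 0 < e & forall y, y \in X -> e < y.
Proof.
elim: X => [|z X IH] H; first by exists 1.
have [y yX|e e0 eX] := IH; first by apply: H; rewrite inE yX orbT.
have z0 : 0 < z by apply: H; rewrite inE eqxx.
have m0 : 0 < Num.min e z by rewrite lt_min e0 z0.
have [me mz] : Num.min e z <= e /\ Num.min e z <= z by rewrite !ge_min !lexx orbT.
exists (Num.min e z / 2) => [|y]; first by rewrite divr_gt0.
rewrite inE => /orP[/eqP->|/eX]; lra.
Qed.

(** Modulo Z the grid has finitely many gaps, so some positive [e] is smaller than all of them. *)
Lemma round_down_gap x0 X : exists2 e, 0 < e &
  forall x, round_down x0 X (round_down x0 X x + e) = round_down x0 X x.
Proof.
(* Distance from y to the first point of y' + Z strictly above it. *)
pose gap y y' : R := (Num.floor (y - y') + 1)%:~R - (y - y').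
have [z|e e0 eP] := @exists_pos_lt [seq gap y y' | y <- x0 :: X, y' <- x0 :: X].
  by move=> /allpairsP[[y y'] [_ _ ->]]; rewrite /gap subr_gt0 floorD1_gt.
exists e => // x; have [y [k [yX E]]] := round_down_mem x0 X x.
apply/eqP; rewrite eq_le; apply/andP; split; last first.
  rewrite -{1}round_downK; apply: (round_down_degree_one x0 X).1.
  by rewrite lerDl ltW.
rewrite E; apply: round_down_leP => y' y'X.
have /eP : gap y y' \in [seq gap y y' | y <- x0 :: X, y' <- x0 :: X].
  by apply/allpairsP; exists (y, y').
rewrite /round1 /gap => h; suff : (Num.floor (y + k%:~R + e - y') <= Num.floor (y - y') + k)%R.
  rewrite -(ler_int R) intrD; have := floor_le (y - y'); lra.
rewrite -ltzD1 floor_lt_int; move: h; rewrite !intrD; lra.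
Qed.

(** The outer rounding keeps orbits in the grid. The inner one makes the map constant just to the
    right of each grid point, which leaves room for a perturbation. *)
Definition rounded x0 X f x : R := round_down x0 X (f (round_down x0 X x)).

Lemma rounded_degree_one x0 X f : degree_one (rounded x0 X f).
Proof.
apply: (degree_one_comp (round_down_degree_one x0 X)).
exact: (degree_one_comp (lift_degree_one f) (round_down_degree_one x0 X)).
Qed.

Lemma rounded_le x0 X f x : rounded x0 X f x <= f x.
Proof.
apply: le_trans (round_down_le _ _ _) _.
by apply: (lift_degree_one f).1; exact: round_down_le.
Qed.

(** Pigeonhole: an orbit in the grid meets at most [(size X).+1] classes modulo Z, so two of its
    first [(size X).+2] points differ by an integer. *)
Lemma rounded_periodic x0 X f : exists (m : nat) (l : int) (z : R),
  [/\ (0 < m <= (size X).+1)%N, round_down x0 X z = z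
    & iter m (rounded x0 X f) z = z + l%:~R].
Proof.
pose F := rounded x0 X f; pose n := (size X).+1.
pose orb i := iter i F (round_down x0 X 0).
have orbE i : exists yk : R * int, yk.1 \in x0 :: X /\ orb i = yk.1 + yk.2%:~R.
  case: i => [|i].
    by have [y [k H]] := round_down_mem x0 X 0; exists (y, k).
  by have [y [k H]] := round_down_mem x0 X (f (round_down x0 X (orb i))); exists (y, k).
pose yk i := projT1 (cid (orbE i)).
have ykX i : (yk i).1 \in x0 :: X by rewrite /yk; case: cid => ? [].
have ykE i : orb i = (yk i).1 + (yk i).2%:~R by rewrite /yk; case: cid => ? [].
pose s := [seq (yk i).1 | i <- iota 0 n.+1].
have : ~~ uniq s.
  apply/negP => us; have : (size s <= size (x0 :: X))%N.
    by apply: uniq_leq_size => // _ /mapP[i _ ->].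
  by rewrite size_map size_iota /n /= ltnn.
move=> /(uniqPn 0)[i [j [ij]]]; rewrite size_map size_iota => jn.
have inn := ltn_trans ij jn.
rewrite !(nth_map 0%N) ?size_iota // !nth_iota // !add0n => e.
exists (j - i)%N, ((yk j).2 - (yk i).2), (orb i); split.
- by rewrite subn_gt0 ij /=; rewrite ltnS in jn; apply: leq_trans jn; exact: leq_subr.
- by rewrite ykE round_down_id.
- rewrite -iterD subnK ?(ltnW ij) // -/(orb j) !ykE e rmorphB /=; ring.
Qed.

(* Moving the orbit grid by less than its gap makes room for a homeomorphism
   with the combinatorics of the rounded map. *)
Lemma rounded_lift x0 X f : exists (f' : homeo_lift R) (m : nat) (l : int),
  [/\ (0 < m <= (size X).+1)%N, m%:R * rot f' = l%:~R, l%:~R <= m%:R * rot f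
    & forall x, rounded x0 X f x <= f' x].
Proof.
have [e e0 eE] := round_down_gap x0 X.
have [m [l [z [mX zE pz]]]] := rounded_periodic x0 X f.
pose F := rounded x0 X f; have dF : degree_one F := rounded_degree_one x0 X f.
have e2 : 0 < e / 2 by rewrite divr_gt0.
have [f' f'E] := lift_between dF e2.
have lowF x : F x <= f' x by have /andP[] := f'E x.
exists f', m, l; split=> //; last first.
  apply: (@le_rot _ f m l z); rewrite -pz.
  by apply: iter_homo_le; [exact: (lift_degree_one f).1|exact: rounded_le].
apply/eqP; rewrite eq_le; apply/andP; split; last first.
  apply: (@le_rot _ f' m l z); rewrite -pz.
  by apply: iter_homo_le => //; exact: (lift_degree_one f').1.
(* The orbit of z + e/2 under f' stays at most e/2 above that of z under F: f' (y + e/2) <= F (y +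
   e) + e/2 = F y + e/2 for y in the grid. *)
apply: (@rot_le _ f' m l (z + e / 2)); rewrite addrAC -pz.
elim: m {mX pz} => //= m IH.
apply: le_trans ((lift_degree_one f').1 _ _ IH) _.
have /andP[_] := f'E (iter m F z + e / 2).
suff -> : F (iter m F z + e / 2 + e / 2) = F (iter m F z) by [].
have zm : round_down x0 X (iter m F z) = iter m F z.
  by case: m {IH} => //= m; rewrite round_downK.
rewrite -addrA -splitr /F /rounded -/F -[in LHS]zm eE.
by rewrite zm.
Qed.

Fixpoint orbit f g (s : seq bool) x : seq R :=
  eval_word f g s x :: if s is _ :: s' then orbit f g s' x else [::].

Lemma size_orbit f g s x : size (orbit f g s x) = (size s).+1.
Proof. by elim: s => //= l s ->. Qed.

(** Rounding fixes grid points, so a map is unchanged where both the point and its image lie in the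
    grid. *)
Lemma eval_rounded f g s x x0 X : {subset orbit f g s x <= x0 :: X} ->
  eval_word (rounded x0 X f) (rounded x0 X g) s x = eval_word f g s x.
Proof.
have rid y : y \in x0 :: X -> round_down x0 X y = y.
  by move=> yX; have := round_down_id 0 yX; rewrite addr0.
elim: s => //= l s IH sub; rewrite IH; last first.
  by move=> y ys; apply: sub; rewrite inE ys orbT.
have h1 : round_down x0 X (eval_word f g s x) = eval_word f g s x.
  apply: rid; apply: sub; rewrite inE; apply/orP; right.
  by case: s {IH} => [|? ?]; rewrite inE eqxx.
have h2 : round_down x0 X (if l then g (eval_word f g s x) else f (eval_word f g s x))
  = if l then g (eval_word f g s x) else f (eval_word f g s x).
  by apply: rid; apply: sub; rewrite inE eqxx.
by rewrite /rounded h1; case: l h2 {sub}.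
Qed.

(** The factorial is a multiple of every period that rounding to the orbit can produce, so it serves
    as denominator for all f and g at once. *)
Lemma rational_lifts f g s x (p : int) :
  x + p%:~R <= eval_word f g s x ->
  let D := (size s).+1`! in
  exists (f' g' : homeo_lift R) (i j : int),
    [/\ D%:R * rot f' = i%:~R, D%:R * rot g' = j%:~R,
        i%:~R <= D%:R * rot f, j%:~R <= D%:R * rot g
      & x + p%:~R <= eval_word f' g' s x].
Proof.
move=> H D.
have [x0 [X E]] : exists x0 X, orbit f g s x = x0 :: X by case: s {H D} => *; do 2 eexists.
have sX : (size X).+1 = (size s).+1 by rewrite -(size_orbit f g s x) E.
have toD (h h' : homeo_lift R) (m : nat) (l : int) :
    (0 < m <= (size X).+1)%N -> m%:R * rot h' = l%:~R -> l%:~R <= m%:R * rot h ->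
    exists i : int, D%:R * rot h' = i%:~R /\ i%:~R <= D%:R * rot h.
  rewrite sX => mD e le; have /dvdnP[k kE] := dvdn_fact mD.
  exists (k%:Z * l); rewrite /D kE natrM intrM -pmulrn -!mulrA e; split=> //.
  by rewrite ler_wpM2l.
have [f' [m [l [mX e le Ff]]]] := rounded_lift x0 X f.
have [i [i1 i2]] := toD f f' m l mX e le.
have [g' [m' [l' [mX' e' le' Gg]]]] := rounded_lift x0 X g.
have [j [j1 j2]] := toD g g' m' l' mX' e' le'.
exists f', g', i, j; split=> //; apply: le_trans H _.
rewrite -(@eval_rounded f g s x x0 X) ?E //.
by apply: eval_word_le => //; exact: lift_degree_one.
Qed.

End Rounding.

(** * Uniform conjugation *)

Section UniformConjugation.
Context {R : realType}.
Implicit Types (f g h : homeo_lift R) (x y : R).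

(* An iterate of a contraction on degree one maps: its fixed point [phi]
   satisfies [phi (f y) - phi (f x) <= 4 (phi y - phi x)], and likewise for
   [g], since the other summands are nondecreasing. *)
Fixpoint averaged f g (n : nat) x : R :=
  if n is k.+1 then x / 2 + averaged f g k (f x) / 4 + averaged f g k (g x) / 4
  else x.

Lemma averaged_lt f g n : {homo averaged f g n : x y / x < y}.
Proof.
elim: n => //= n IH x y xy.
have := IH _ _ (lift_increasing f xy); have := IH _ _ (lift_increasing g xy).
lra.
Qed.

Lemma averaged_continuous f g n : continuous (averaged f g n).
Proof.
elim: n => [|n IH] x /=; first exact: cvg_id.
apply: cvgD; first apply: cvgD.
- by apply: cvgM; [exact: cvg_id|exact: cvg_cst].
- apply: cvgM; last exact: cvg_cst.
  by apply: (cvg_comp _ _ (@lift_continuous _ f x)); exact: IH.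
- apply: cvgM; last exact: cvg_cst.
  by apply: (cvg_comp _ _ (@lift_continuous _ g x)); exact: IH.
Qed.

Lemma averaged_add1 f g n x : averaged f g n (x + 1) = averaged f g n x + 1.
Proof. by elim: n x => //= n IH x; rewrite !lift_add1 !IH; field. Qed.

(** The two weights 1/4 sum to 1/2, so each step halves the difference. *)
Lemma averaged_cauchy f g n x :
  `|averaged f g n.+1 x - averaged f g n x| <= (`|f 0| + `|g 0| + 2) / 2 ^+ n.
Proof.
elim: n x => [|n IH] x.
  have := degree_one_near_id x (lift_degree_one f).
  have := degree_one_near_id x (lift_degree_one g).
  rewrite expr0 divr1 /= !ler_norml => /andP[? ?] /andP[? ?].
  by have := normr_ge0 (f 0); have := normr_ge0 (g 0) => ? ?; apply/andP; split; lra.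
have E (M : R) : M / 2 ^+ n.+1 = M / 2 ^+ n / 2.
  by rewrite exprS invfM mulrA mulrAC.
have := IH (f x); have := IH (g x).
rewrite E; set C := _ / 2 ^+ n; rewrite !ler_norml.
rewrite -[averaged f g n.+2 x]/(x / 2 + averaged f g n.+1 (f x) / 4 + averaged f g n.+1 (g x) / 4).
rewrite -[averaged f g n.+1 x]/(x / 2 + averaged f g n (f x) / 4 + averaged f g n (g x) / 4).
by move=> /andP[? ?] /andP[? ?]; apply/andP; split; lra.
Qed.

(** The error [e] accounts for conjugating by a finite iterate of the averaging instead of its fixed
    point. *)
Definition almost_lipschitz (e : R) f :=
  forall x y, x <= y -> f y - f x <= 4 * (y - x) + e.

Lemma exists_almost_lipschitz_conj f g (e : R) : 0 < e -> exists h,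
  almost_lipschitz e (h * f * h^-1)%g /\ almost_lipschitz e (h * g * h^-1)%g.
Proof.
move=> e0; pose C : R := `|f 0| + `|g 0| + 2.
(* The constant 4 multiplies two errors C / 2^n, one at each end point. *)
have [n ne] : exists n, 8 * (C / 2 ^+ n) <= e.
  pose n := (Num.truncn (8 * C / e)).+1; exists n.
  have nC : 8 * C / e < n%:R by exact: truncnS_gt.
  rewrite mulrA ler_pdivrMr ?exprn_gt0 // [X in _ <= X]mulrC -ler_pdivrMr //.
  apply: le_trans (ltW nC) _.
  have -> : 2 ^+ n = (2 ^ n)%:R :> R by rewrite natrX.
  by rewrite ler_nat ltnW // ltn_expl.
have [h hE] := degree_one_lift (@averaged_lt f g n) (@averaged_continuous f g n)
  (averaged_add1 f g n).
have av x y : x <= y -> averaged f g n x <= averaged f g n y.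
  by rewrite -hE; exact: (lift_degree_one h).1.
suff key (u : homeo_lift R) : (forall x y, x <= y ->
      averaged f g n (u y) - averaged f g n (u x) <=
      4 * (averaged f g n.+1 y - averaged f g n.+1 x)) ->
    almost_lipschitz e (h * u * h^-1)%g.
  exists h; split; apply: key => x y xy /=.
    by have := av _ _ ((lift_degree_one g).1 _ _ xy); lra.
  by have := av _ _ ((lift_degree_one f).1 _ _ xy); lra.
move=> H x y xy; rewrite !lift_mulE hE.
have := H _ _ ((lift_degree_one h^-1%g).1 _ _ xy).
have := averaged_cauchy f g n (h^-1%g x); have := averaged_cauchy f g n (h^-1%g y).
have hK z : averaged f g n (h^-1%g z) = z by rewrite -hE; exact: lift_invK.
rewrite !hK -/C !ler_norml => /andP[? ?] /andP[? ?]; lra.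
Qed.

(** The distance d between the two orbits of 0 grows by d -> 4 d + e + t at most; 5^n (e + t)
    absorbs this, as 4 * 5^n + 1 <= 5^(n+1). The final 2 is twice the error of [rot_bound0]. *)
Lemma rot_translation_le f (e t : R) n : almost_lipschitz e f -> 0 <= e -> 0 <= t ->
  n%:R * rot (translation t * f)%g <= n%:R * rot f + 5 ^+ n * (e + t) + 2.
Proof.
move=> Lf e0 t0.
have : iter n (translation t * f)%g 0 <= iter n f 0 + 5 ^+ n * (e + t).
  elim: n => [|n IH] /=; first by rewrite add0r expr0 mul1r addr_ge0.
  rewrite translationE exprS.
  have le : iter n f 0 <= iter n (translation t * f)%g 0.
    apply: iter_homo_le; first exact: (lift_degree_one _).1.
    by move=> y; rewrite lift_mulE translationE lerDl.
  have := Lf _ _ le; have : 1 * (e + t) <= 5 ^+ n * (e + t).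
    by rewrite ler_wpM2r ?addr_ge0 // exprn_ege1 // ler1n.
  move: IH; set a := iter n _ 0; set b := iter n f 0; set E := _ ^+ n * _.
  rewrite -[5 * _ * _]mulrA -/E; lra.
have /andP[h1 _] := rot_bound0 f n.
have /andP[_ h2] := rot_bound0 (translation t * f)%g n.
lra.
Qed.

(** The outermost letter alone gains t, and the letters before it lose nothing. *)
Lemma eval_word_translation f g (t : R) l s x : 0 <= t ->
  eval_word f g (l :: s) x + t <=
  eval_word (translation t * f)%g (translation t * g)%g (l :: s) x.
Proof.
move=> t0.
have up (u : homeo_lift R) y : u y <= (translation t * u)%g y.
  by rewrite lift_mulE translationE lerDl.
have := @eval_word_le _ f g _ _ s x (lift_degree_one _) (lift_degree_one _) (up f) (up g).
rewrite /= => H.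
by case: l; rewrite translationE lerD2r; apply: (lift_degree_one _).1.
Qed.

End UniformConjugation.

(** * Corners with bounded denominators *)

Section Corners.
Context {R : realType}.

Lemma int_margin (D : nat) (r : R) : (0 < D)%N ->
  exists2 e, 0 < e & forall i : int, i%:~R <= D%:R * (r + e) -> i%:~R <= D%:R * r.
Proof.
move=> D0; have DR : 0 < D%:R :> R by rewrite ltr0n.
pose k := Num.floor (D%:R * r).
have /andP[k1 k2] := floor_itv (D%:R * r).
(* Puts D (r + e) halfway between D r and the first integer above it. *)
exists (((k + 1)%:~R - D%:R * r) / (2 * D%:R)) => [|i].
  by rewrite divr_gt0 ?mulr_gt0 // subr_gt0.
have -> : D%:R * (r + ((k + 1)%:~R - D%:R * r) / (2 * D%:R)) =
  ((k + 1)%:~R + D%:R * r) / 2 by field; rewrite gt_eqF.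
move=> ik; apply: le_trans k1; rewrite ler_int -ltzD1 -(ltr_int R).
by apply: le_lt_trans ik _; rewrite -/k in k2 *; lra.
Qed.

(** [D] depends on [w] and [c] only, so that one grid contains the corners for all (r, s). *)
Lemma max_rot_corner (w : F2) (c : rat) : positive w ->
  exists2 D : nat, (0 < D)%N & forall r s : R, 0 <= r -> 0 <= s ->
    ratr c <= max_rot w r s -> exists i j : nat,
    [/\ i%:R / D%:R <= r, j%:R / D%:R <= s
      & ratr c <= max_rot w (i%:R / D%:R : R) (j%:R / D%:R)].
Proof.
move=> pw; set L := letters w.
pose q := `|denq c|%N; pose p := numq c.
have q0 : (0 < q)%N by rewrite absz_gt0 denq_neq0.
have qR : 0 < q%:R :> R by rewrite ltr0n.
have cE : ratr c = p%:~R / q%:R :> R.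
  by rewrite /ratr /q [in RHS]pmulrn absz_denq.
pose W := flatten (nseq q L); pose D := (size W).+1`!.
have D0 : (0 < D)%N by exact: fact_gt0.
have DR : 0 < D%:R :> R by rewrite ltr0n.
exists D => // r s r0 s0 rs.
(* The empty word acts as the identity whatever r and s are, so the origin serves as corner.
   Otherwise there is a letter through which a translation can act. *)
case EL : L => [|l L'].
  exists 0%N, 0%N; rewrite !mul0r; split=> //.
  rewrite leNgt; apply/negP => /lt_le_trans-/(_ _ rs) /(lt_max_rot pw).
  move=> [f [g [_ _]]]; rewrite -/L EL ltNge => /negP; apply.
  have := rot_le_max_rot (translation (0 : R)) (translation 0) pw.
  by rewrite !rot_translation -/L EL.
have [W' EW] : exists W', W = l :: W'.
  by rewrite /W EL; case: (q) q0 => //= q' _; eexists.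
have [e1 e10 e1P] := int_margin r D0; have [e2 e20 e2P] := int_margin s D0.
(* The bound 3 pays for 5^n (t + t) = 1 and the constant 2 in [rot_translation_le]. Both [n] and [t]
   are fixed before f and g are chosen. *)
pose n := (Num.truncn (3 / e1 + 3 / e2)).+1.
have nR : 0 < n%:R :> R by rewrite ltr0n.
have [ne1 ne2] : 3 <= n%:R * e1 /\ 3 <= n%:R * e2.
  have h : 3 / e1 + 3 / e2 < n%:R by exact: truncnS_gt.
  have h1 : 0 < 3 / e1 by rewrite divr_gt0.
  have h2 : 0 < 3 / e2 by rewrite divr_gt0.
  by rewrite -!ler_pdivrMr //; split; lra.
pose t : R := (5 ^+ n)^-1 / 2.
have n5 : 0 < 5 ^+ n :> R by rewrite exprn_gt0.
have t0 : 0 < t by rewrite divr_gt0 ?invr_gt0.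
have t5 : 5 ^+ n * (t + t) = 1 by rewrite /t -splitr mulfV // gt_eqF.
(* Losing t / q in the rotation number costs less than t after q iterations, which the translation
   by t regains. *)
have : ratr c - t / q%:R < max_rot w r s.
  by apply: lt_le_trans rs; rewrite ltrBlDr ltrDl divr_gt0.
move=> /(lt_max_rot pw)[f0 [g0 [fr gs lt0]]]; rewrite -/L in lt0.
have [h [Lf Lg]] := exists_almost_lipschitz_conj f0 g0 t0.
set f := (h * f0 * h^-1)%g in Lf; set g := (h * g0 * h^-1)%g in Lg.
have [x xE] : exists x, x + (p%:~R - t) < iter q (eval_lift f g L) x.
  apply: lt_rot_iter; rewrite /f /g eval_lift_conj rot_conj.
  move: lt0; rewrite cE -mulrBl ltr_pdivrMr // mulrC.
  by rewrite [X in _ < X]mulrC [X in _ < X]mulrC.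
pose f2 := (translation t * f)%g; pose g2 := (translation t * g)%g.
have iterE u v : iter q (eval_lift u v L) = eval_word u v W.
  apply/funext => y; rewrite /W eval_word_flatten.
  by apply: eq_iter => z; rewrite eval_liftE.
have : x + p%:~R <= eval_word f2 g2 W x.
  have := eval_word_translation f g l W' x (ltW t0).
  move: xE; rewrite iterE EW -/f2 -/g2; lra.
move=> /rational_lifts; rewrite -/D => -[f3 [g3 [i [j [fi gj ir js wp]]]]].
have small u v b : rot u = v -> almost_lipschitz t u -> 3 <= n%:R * b ->
    rot (translation t * u)%g <= v + b.
  move=> uv Lu nb; rewrite -(ler_pM2l nR).
  have := rot_translation_le n Lu (ltW t0) (ltW t0).
  by rewrite t5 uv; lra.
have fle : rot f2 <= r + e1 by apply: small => //; rewrite /f rot_conj.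
have gle : rot g2 <= s + e2 by apply: small => //; rewrite /g rot_conj.
(* By choice of the margin, raising r by [e1] passes no new multiple of 1 / D. *)
have {ir} ir : i%:~R <= D%:R * r.
  by apply: e1P; apply: le_trans ir _; rewrite ler_pM2l.
have {js} js : j%:~R <= D%:R * s.
  by apply: e2P; apply: le_trans js _; rewrite ler_pM2l.
have c3 : ratr c <= rot (eval_lift f3 g3 L).
  rewrite cE ler_pdivrMr // mulrC; apply: (@le_rot _ _ q p x).
  by rewrite iterE.
(* A negative numerator is replaced by 0; monotonicity of [max_rot] allows this increase. *)
have posp (k : int) (v : R) : 0 <= v -> k%:~R <= D%:R * v ->
    exists2 k' : nat, k%:~R <= k'%:R :> R & k'%:R / D%:R <= v.
  case: k => k v0 kv.
    by exists k => //; rewrite ler_pdivrMr // mulrC.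
  by exists 0%N; rewrite ?mul0r // -[X in _ <= X]/((0%:~R : R)) ler_int.
have [i' ii' i'r] := posp i r r0 ir; have [j' jj' j's] := posp j s s0 js.
exists i', j'; split=> //; apply: le_trans c3 _.
apply: le_trans (rot_le_max_rot f3 g3 pw) _.
by apply: max_rot_le => //; rewrite ler_pdivlMr // mulrC ?fi ?gj.
Qed.

End Corners.

(** * Staircase polygons *)

Section Boxes.
Context {R : realType}.
Implicit Types (P : seq (R * R)) (z : R * R).

(** Weights indexed by naturals let the sums over explicit lists of vertices unfold. *)
Lemma convex_hullP P z : convex_hull P z <-> exists c : nat -> R,
  [/\ forall i, 0 <= c i, \sum_(i < size P) c i = 1,
      z.1 = \sum_(i < size P) c i * (nth (0, 0) P i).1
    & z.2 = \sum_(i < size P) c i * (nth (0, 0) P i).2].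
Proof.
split=> [[c [c0 c1 z1 z2]]|[c [c0 c1 z1 z2]]].
  pose d (i : nat) : R := if insub i is Some j then c j else 0.
  have dE (i : 'I_(size P)) : d i = c i by rewrite /d valK.
  exists d; split.
  - by move=> i; rewrite /d; case: insub.
  - by rewrite -c1; apply: eq_bigr.
  - by rewrite z1; apply: eq_bigr => i _; rewrite dE (tnth_nth (0, 0)).
  - by rewrite z2; apply: eq_bigr => i _; rewrite dE (tnth_nth (0, 0)).
exists (fun i => c i); split=> //.
  by rewrite z1; apply: eq_bigr => i _; rewrite (tnth_nth (0, 0)).
by rewrite z2; apply: eq_bigr => i _; rewrite (tnth_nth (0, 0)).
Qed.

Definition box (x0 x1 y0 y1 : R) : set (R * R) :=
  [set z | x0 <= z.1 <= x1 /\ y0 <= z.2 <= y1].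

Lemma between_combination (x0 x1 x : R) : x0 <= x <= x1 ->
  exists t, [/\ 0 <= t, t <= 1 & x = (1 - t) * x0 + t * x1].
Proof.
move=> /andP[h0 h1]; have [e|ne] := eqVneq x0 x1.
  by exists 0; rewrite lexx ler01; split=> //; lra.
have d0 : 0 < x1 - x0 by rewrite subr_gt0 lt_neqAle ne (le_trans h0 h1).
exists ((x - x0) / (x1 - x0)); split.
- by rewrite divr_ge0 ?(ltW d0) // subr_ge0.
- by rewrite ler_pdivrMr // mul1r; lra.
- by field; rewrite gt_eqF.
Qed.

Lemma convex_hull_box (x0 x1 y0 y1 : R) : x0 <= x1 -> y0 <= y1 ->
  convex_hull [:: (x0, y0); (x1, y0); (x0, y1); (x1, y1)] = box x0 x1 y0 y1.
Proof.
move=> hx hy; apply/seteqP; split=> [z /convex_hullP|z [zx zy]].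
  move=> [c [c0 c1 z1 z2]]; move: c1 z1 z2; rewrite !big_ord_recr !big_ord0 /=.
  rewrite !add0r => c1 z1 z2.
  have x10 : 0 <= x1 - x0 by rewrite subr_ge0.
  have y10 : 0 <= y1 - y0 by rewrite subr_ge0.
  have c0E : c 0%N = 1 - c 1%N - c 2%N - c 3%N by lra.
  have := mulr_ge0 (addr_ge0 (c0 1%N) (c0 3%N)) x10.
  have := mulr_ge0 (addr_ge0 (c0 0%N) (c0 2%N)) x10.
  have := mulr_ge0 (addr_ge0 (c0 2%N) (c0 3%N)) y10.
  have := mulr_ge0 (addr_ge0 (c0 0%N) (c0 1%N)) y10.
  by rewrite /box /= z1 z2 c0E => ? ? ? ?; split; apply/andP; split; lra.
have [t [t0 t1 zt]] := between_combination zx.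
have [u [u0 u1 zu]] := between_combination zy.
have t1' : 0 <= 1 - t by lra.
have u1' : 0 <= 1 - u by lra.
(* Products of the barycentric weights of the two coordinates. *)
apply/convex_hullP; exists (nth 0 [:: (1 - t) * (1 - u); t * (1 - u); (1 - t) * u; t * u]).
split.
- by move=> i; do 4 (case: i => [|i] /=; first by rewrite mulr_ge0); rewrite nth_nil.
- by rewrite !big_ord_recr !big_ord0 /=; ring.
- by rewrite !big_ord_recr !big_ord0 /= zt; ring.
- by rewrite !big_ord_recr !big_ord0 /= zu; ring.
Qed.

Lemma convex_hull_segment (x0 x1 y0 y1 : R) : x0 <= x1 -> y0 <= y1 ->
  x0 = x1 \/ y0 = y1 -> convex_hull [:: (x0, y0); (x1, y1)] = box x0 x1 y0 y1.
Proof.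
move=> hx hy xy; apply/seteqP; split=> [z /convex_hullP|z [zx zy]].
  move=> [c [c0 c1 z1 z2]]; move: c1 z1 z2; rewrite !big_ord_recr !big_ord0 /=.
  rewrite !add0r => c1 z1 z2.
  have x10 : 0 <= x1 - x0 by rewrite subr_ge0.
  have y10 : 0 <= y1 - y0 by rewrite subr_ge0.
  have c0E : c 0%N = 1 - c 1%N by lra.
  have := mulr_ge0 (c0 1%N) x10; have := mulr_ge0 (c0 0%N) x10.
  have := mulr_ge0 (c0 1%N) y10; have := mulr_ge0 (c0 0%N) y10.
  by rewrite /box /= z1 z2 c0E => ? ? ? ?; split; apply/andP; split; lra.
have [t [t0 t1 ztx zty]] : exists t, [/\ 0 <= t, t <= 1,
    z.1 = (1 - t) * x0 + t * x1 & z.2 = (1 - t) * y0 + t * y1].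
  case: xy => e.
    have [t [t0 t1 zt]] := between_combination zy; exists t; split=> //.
    by move: zx; rewrite e => /andP[? ?]; lra.
  have [t [t0 t1 zt]] := between_combination zx; exists t; split=> //.
  by move: zy; rewrite e => /andP[? ?]; lra.
have t1' : 0 <= 1 - t by lra.
apply/convex_hullP; exists (nth 0 [:: 1 - t; t]); split.
- by case=> [|[|i]] //=; rewrite nth_nil.
- by rewrite !big_ord_recr !big_ord0 /=; ring.
- by rewrite !big_ord_recr !big_ord0 /= ztx; ring.
- by rewrite !big_ord_recr !big_ord0 /= zty; ring.
Qed.

Lemma box_closed x0 x1 y0 y1 : closed (box x0 x1 y0 y1).
Proof.
have -> : box x0 x1 y0 y1 =
    (fst @^-1` ([set x | x0 <= x] `&` [set x | x <= x1])) `&`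
    (snd @^-1` ([set y | y0 <= y] `&` [set y | y <= y1])).
  apply/seteqP; split=> z; rewrite /box /=.
    by move=> [/andP[? ?] /andP[? ?]].
  by move=> [[-> ->] [-> ->]].
have cf : continuous (fst : R * R -> R) by move=> z; exact: cvg_fst.
have cs : continuous (snd : R * R -> R) by move=> z; exact: cvg_snd.
apply: closedI; apply: closed_comp => //; first [by move=> z _; exact: cf |
  by move=> z _; exact: cs | by apply: closedI; [exact: closed_ge|exact: closed_le]].
Qed.

(** The set is the union of the segments joining its points to p, which all share p. *)
Lemma star_connected (A : set (R * R)) (p : R * R) :
  (forall z (t : R), A z -> 0 <= t <= 1 ->
    A (p.1 + t * (z.1 - p.1), p.2 + t * (z.2 - p.2))) ->
  connected A.
Proof.
move=> star.
pose seg z : set (R * R) :=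
  [set (p.1 + t * (z.1 - p.1), p.2 + t * (z.2 - p.2)) | t in (`[0, 1]%classic : set R)].
have -> : A = \bigcup_(z in A) seg z.
  apply/seteqP; split=> [z Az|_ [z Az [t t01 <-]]]; last exact: star.
  exists z => //; exists 1; first by rewrite /= in_itv /= ler01 lexx.
  by rewrite !mul1r !subrKC -surjective_pairing.
apply: bigcup_connected.
  exists p => z _; exists 0; first by rewrite /= in_itv /= lexx ler01.
  by rewrite !mul0r !addr0 -surjective_pairing.
move=> z _; apply: connected_continuous_connected.
  exact: segment_connected.
have lin (a b : R) : continuous (fun t : R => a + t * b).
  by move=> t; apply: cvgD; [exact: cvg_cst|apply: cvgM; [exact: cvg_id|exact: cvg_cst]].
apply: continuous_subspaceT => t.
exact: (cvg_pair (lin _ _ t) (lin _ _ t)).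
Qed.

End Boxes.

(** * Unions of boxes with corners on a grid *)

Section Staircase.
Context {R : realType}.
Context (D : nat) (P : nat -> nat -> Prop) (D0 : (0 < D)%N).

Definition staircase : set (R * R) :=
  [set z | [/\ z.1 <= 1, z.2 <= 1 & exists i j : nat,
    [/\ P i j, i%:R / D%:R <= z.1 & j%:R / D%:R <= z.2]]].

Let grid (i : nat) : R := i%:R / D%:R.
Let qgrid (i : nat) : rat := i%:R / D%:R.

Let DR : 0 < D%:R :> R. Proof. by rewrite ltr0n. Qed.

Let qgridE i : ratr (qgrid i) = grid i.
Proof. by rewrite fmorph_div /= !ratr_nat. Qed.

Let gridD : grid D = 1.
Proof. by rewrite /grid divff // gt_eqF. Qed.

Let grid_le i j : (grid i <= grid j) = (i <= j)%N.
Proof. by rewrite /grid ler_pM2r ?invr_gt0 // ler_nat. Qed.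

Let grid_ge0 i : 0 <= grid i.
Proof. by rewrite divr_ge0. Qed.

Let grid_le1 i : (grid i <= 1) = (i <= D)%N.
Proof. by rewrite -gridD grid_le. Qed.

Let grid_indices : exists ns : seq nat, forall i, (i \in ns) = (i <= D)%N.
Proof. by exists (iota 0 D.+1) => i; rewrite mem_iota /= add0n ltnS. Qed.

(** Corners with an index above [D] lie outside the unit square, so finitely many boxes suffice. *)
Lemma staircase_bigcup :
  staircase = \bigcup_(ij in [set ij : nat * nat |
      [/\ P ij.1 ij.2, (ij.1 <= D)%N & (ij.2 <= D)%N]])
    box (grid ij.1) 1 (grid ij.2) 1.
Proof.
apply/seteqP; split=> [z [z1 z2 [i [j [Pij iz jz]]]]
  |z [[i j] [Pij _ _] [/= /andP[h1 h2] /andP[h3 h4]]]].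
  exists (i, j); last by rewrite /box /= z1 z2 /grid iz jz.
  by split=> //=; rewrite -grid_le1; [exact: le_trans iz z1|exact: le_trans jz z2].
by split=> //; exists i, j.
Qed.

Lemma staircase_closed : closed staircase.
Proof.
rewrite staircase_bigcup; apply: closed_bigcup => [|ij _]; last exact: box_closed.
apply: (@sub_finite_set _ _ (`I_D.+1 `*` `I_D.+1)); last first.
  by apply: finite_setX; exact: finite_II.
by move=> [i j] [_ /= iD jD]; split=> /=; rewrite ltnS.
Qed.

(** Every box contains (1, 1), so the union is star-shaped about it. *)
Lemma staircase_connected : connected staircase.
Proof.
apply: (@star_connected _ _ (1, 1)) => z t [z1 z2 [i [j [Pij iz jz]]]] /andP[t0 t1].
have h1 : 0 <= t * (1 - z.1) by rewrite mulr_ge0 // subr_ge0.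
have h2 : 0 <= t * (1 - z.2) by rewrite mulr_ge0 // subr_ge0.
have h3 : 0 <= (1 - t) * (1 - z.1) by rewrite mulr_ge0 // subr_ge0.
have h4 : 0 <= (1 - t) * (1 - z.2) by rewrite mulr_ge0 // subr_ge0.
by split=> /=; [lra|lra|exists i, j; split=> //=; lra].
Qed.

(* Leftward and vertical rays avoiding the staircase join any point of the
   complement to [(-1, -1)]. *)
Lemma staircase_compl_connected : connected (~` staircase).
Proof.
have step z : ~ staircase z -> exists C : set (R * R),
    [/\ connected C, C (-1, -1), C z & C `<=` ~` staircase].
  move=> Sz.
  have vert (a : R) : connected [set u : R * R | u.1 = a].
    by apply: (@star_connected _ _ (a, -1)) => u t /= -> _; rewrite subrr mulr0 addr0.
  have horiz (a b : R) : -1 <= a -> connected [set u : R * R | u.2 = b /\ u.1 <= a].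
    move=> a1; apply: (@star_connected _ _ (-1, b)) => u t [/= -> ua] /andP[t0 t1].
    split; first by rewrite subrr mulr0 addr0.
    have h1 : 0 <= t * (a - u.1) by rewrite mulr_ge0 // subr_ge0.
    have h2 : 0 <= (1 - t) * (a + 1) by rewrite mulr_ge0 //; lra.
    lra.
  have Sneg u : u.1 < 0 \/ u.2 < 0 -> ~ staircase u.
    move=> neg [_ _ [i [j [_ iu ju]]]].
    by have := grid_ge0 i; have := grid_ge0 j; move: iu ju neg; rewrite -!/(grid _); lra.
  (* To the right of the square the vertical line through z is free; from there one goes left at
     height -1. *)
  have [z1|z1] := ltP 1 z.1.
    have z1' : -1 <= z.1 by lra.
    exists ([set u | u.1 = z.1] `|` [set u | u.2 = -1 /\ u.1 <= z.1]); split.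
    - by apply: connectedU; [exists (z.1, -1)|exact: vert|exact: horiz].
    - by right.
    - by left.
    - move=> u [/= uz [u1 _ _]|[/= u2 _]]; first by move: u1; rewrite uz leNgt z1.
      by apply: Sneg; right; rewrite u2; lra.
  (* A staircase point to the left of z at its height would put z in the staircase. The maximum
     makes the ray meet the line of abscissa -1 even if z lies to its left. *)
  have M1 : -1 <= Num.max z.1 (-1) by rewrite le_max lexx orbT.
  exists ([set u | u.1 = -1] `|` [set u | u.2 = z.2 /\ u.1 <= Num.max z.1 (-1)]); split.
  - by apply: connectedU; [exists (-1, z.2)|exact: vert|exact: horiz].
  - by left.
  - by right; split=> //; rewrite le_max lexx.
  - move=> u [/= u1|[/= u2 uM]]; first by apply: Sneg; left; rewrite u1; lra.
    move: uM; rewrite le_max => /orP[uz [_ uz2 [i [j [Pij iu ju]]]]|u1].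
      apply: Sz; split=> //; first by rewrite -u2.
      by exists i, j; split=> //; [exact: le_trans iu uz|rewrite -u2].
    by apply: Sneg; left; lra.
pose C z : set (R * R) :=
  if pselect (~ staircase z) is left h then projT1 (cid (step z h)) else set0.
have CP z : ~ staircase z ->
    [/\ connected (C z), C z (-1, -1), C z z & C z `<=` ~` staircase].
  by rewrite /C => Sz; case: pselect => // h; case: cid.
have -> : ~` staircase = \bigcup_(z in ~` staircase) C z.
  apply/seteqP; split=> [z Sz|u [z Sz Czu]]; first by exists z => //; case: (CP z Sz).
  by case: (CP z Sz) => _ _ _; exact.
apply: bigcup_connected => [|z Sz]; last by case: (CP z Sz).
by exists (-1, -1) => z Sz; case: (CP z Sz).
Qed.

Lemma staircase_polygon : rational_polygon staircase.
Proof.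
split; [|exact: staircase_connected|exact: staircase_compl_connected].
have [ns nsP] := grid_indices.
pose corners (ij : nat * nat) : seq (rat * rat) :=
  [:: (qgrid ij.1, qgrid ij.2); (1, qgrid ij.2); (qgrid ij.1, 1); (1, 1)].
exists [seq corners ij | ij <- [seq ij <- [seq (i, j) | i <- ns, j <- ns]
  | `[< P ij.1 ij.2 >]]].
have hullE i j : (i <= D)%N -> (j <= D)%N ->
    convex_hull (map (@rat_point R) (corners (i, j))) = box (grid i) 1 (grid j) 1.
  move=> iD jD; rewrite -convex_hull_box ?grid_le1 //.
  by rewrite /= /rat_point /= !qgridE !rmorph1.
rewrite staircase_bigcup; apply/seteqP; split=> [z [[i j] [/= Pij iD jD] zb]|z [ps /=]].
  exists (corners (i, j)); last by rewrite hullE.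
  apply/mapP; exists (i, j) => //; rewrite mem_filter; apply/andP; split; first exact/asboolP.
  by apply/allpairsP; exists (i, j); rewrite !nsP.
move=> /mapP[ij]; rewrite mem_filter => /andP[/asboolP Pij].
move=> /allpairsP[[i j] [/=]]; rewrite !nsP => iD jD ijE ->.
by move: Pij; rewrite {ij}ijE /= hullE // => Pij; exists (i, j).
Qed.

Let strict_corner z := exists i j, [/\ P i j, grid i < z.1 & grid j < z.2].

Lemma interior_staircase z :
  interior staircase z <-> [/\ z.1 < 1, z.2 < 1 & strict_corner z].
Proof.
split=> [/nbhs_ballP[e /= e0 eS]|[z1 z2 [i [j [Pij iz jz]]]]].
  (* Moving right and up gives the strict upper bounds; moving down and left gives the strict
     corner. *)
  have shift (a b : R) : `|a| < e -> `|b| < e -> staircase (z.1 + a, z.2 + b).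
    by move=> ae be; apply: eS; split; rewrite /ball /= opprD addNKr normrN.
  have he : `|e / 2| < e by rewrite gtr0_norm ?divr_gt0 //; lra.
  have hne : `|- (e / 2)| < e by rewrite normrN.
  have h0 : `|0 : R| < e by rewrite normr0.
  have [/= h1 _ _] := shift (e / 2) 0 he h0.
  have [/= _ h2 _] := shift 0 (e / 2) h0 he.
  have [/= _ _ [i [j [Pij iz jz]]]] := shift _ _ hne hne.
  by split; [lra|lra|exists i, j; split=> //; rewrite /grid; lra].
have [y|e e0 eP] := @exists_pos_lt _ [:: 1 - z.1; 1 - z.2; z.1 - grid i; z.2 - grid j].
  by rewrite !inE => /or4P[] /eqP->; rewrite subr_gt0.
have h1 : e < 1 - z.1 by apply: eP; rewrite !inE eqxx.
have h2 : e < 1 - z.2 by apply: eP; rewrite !inE eqxx !orbT.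
have h3 : e < z.1 - grid i by apply: eP; rewrite !inE eqxx !orbT.
have h4 : e < z.2 - grid j by apply: eP; rewrite !inE eqxx !orbT.
apply/nbhs_ballP; exists e => // u [/=]; rewrite /ball /= !ltr_norml.
move=> /andP[? ?] /andP[? ?]; split; [lra|lra|].
by exists i, j; split=> //; rewrite -/(grid _); lra.
Qed.

Lemma boundary_staircaseE z : boundary staircase z <->
  staircase z /\ ~ [/\ z.1 < 1, z.2 < 1 & strict_corner z].
Proof.
have /closure_id clS := staircase_closed.
rewrite /boundary -clS /setD /=; have E := interior_staircase z.
by split=> -[Sz H]; split=> // /E.
Qed.

(** Used to extend a boundary point to a segment ending on the next grid line: no grid value lies
    between t and it. *)
Let grid_ceil (t : R) : t <= 1 -> exists2 k : nat, (k <= D)%N &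
  t <= grid k /\ forall j, (j < k)%N -> grid j < t.
Proof.
move=> t1; have ex : exists k, t <= grid k by exists D; rewrite gridD.
case: (ex_minnP ex) => k tk kmin; exists k; first by apply: kmin; rewrite gridD.
by split=> // j; apply: contraTT; rewrite -leNgt -leqNgt; exact: kmin.
Qed.

Lemma staircase_rectilinear : rectilinear_boundary staircase.
Proof.
have [ns nsP] := grid_indices.
pose G := [seq (qgrid i, qgrid j) | i <- ns, j <- ns].
pose seg (e : (rat * rat) * (rat * rat)) : set (R * R) :=
  convex_hull [:: rat_point R e.1; rat_point R e.2].
pose good e := axis_parallel e && `[< seg e `<=` boundary staircase >].
(* All axis-parallel grid segments contained in the boundary; it remains to see that they cover
   it. *)
exists [seq e <- [seq (p, q) | p <- G, q <- G] | good e].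
  by apply/allP => e; rewrite mem_filter => /andP[/andP[]].
apply/seteqP; split=> [z bz|z [e /=]]; last first.
  by rewrite mem_filter => /andP[/andP[_ /asboolP H] _]; exact: H.
have GP i j : (i <= D)%N -> (j <= D)%N -> (qgrid i, qgrid j) \in G.
  by move=> iD jD; apply/allpairsP; exists (i, j); rewrite !nsP.
have segE i i' j j' : (i <= i')%N -> (j <= j')%N -> i = i' \/ j = j' ->
    seg ((qgrid i, qgrid j), (qgrid i', qgrid j')) = box (grid i) (grid i') (grid j) (grid j').
  move=> ii jj ij; rewrite /seg /rat_point /= !qgridE convex_hull_segment ?grid_le //.
  by case: ij => ->; [left|right].
have use i i' j j' : (i <= i' <= D)%N -> (j <= j' <= D)%N -> i = i' \/ j = j' ->
    box (grid i) (grid i') (grid j) (grid j') z ->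
    box (grid i) (grid i') (grid j) (grid j') `<=` boundary staircase ->
    (\bigcup_(e in [set` [seq e <- [seq (p, q) | p <- G, q <- G] | good e]]) seg e) z.
  move=> /andP[ii iD] /andP[jj jD] ij zb sub.
  exists ((qgrid i, qgrid j), (qgrid i', qgrid j')); last by rewrite segE.
  rewrite /= mem_filter; apply/andP; split; last first.
    by apply/allpairsP; exists ((qgrid i, qgrid j), (qgrid i', qgrid j')); rewrite /= !GP //;
       [exact: leq_trans ii iD|exact: leq_trans jj jD].
  apply/andP; split; last by apply/asboolP; rewrite segE.
  by rewrite /axis_parallel /=; case: ij => ->; rewrite eqxx ?orbT.
have /boundary_staircaseE[[z1 z2 [i [j [Pij iz jz]]]] nz] := bz.
rewrite -/(grid _) in iz; rewrite -/(grid j) in jz.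
have iD : (i <= D)%N by rewrite -grid_le1; exact: le_trans iz z1.
have jD : (j <= D)%N by rewrite -grid_le1; exact: le_trans jz z2.
have [z11|z1n] := eqVneq z.1 1.
  apply: (use D D j D); rewrite ?leqnn ?jD //; first by left.
    by rewrite /box /= gridD z11 lexx jz z2.
  move=> u [/andP[]]; rewrite gridD => u1 u1' /andP[u2 u2'].
  apply/boundary_staircaseE; split; last by case; rewrite ltNge u1.
  by split=> //; exists i, j; split=> //; apply: le_trans u1; rewrite -/(grid i) grid_le1.
have [z21|z2n] := eqVneq z.2 1.
  apply: (use i D D D); rewrite ?leqnn ?iD //; first by right.
    by rewrite /box /= gridD z21 lexx iz z1.
  move=> u [/andP[u1 u1']]; rewrite gridD in u1' * => /andP[u2 u2'].
  apply/boundary_staircaseE; split; last by case=> _; rewrite ltNge u2.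
  by split=> //; exists i, j; split=> //; apply: le_trans u2; rewrite -/(grid j) grid_le1.
have z1l : z.1 < 1 by rewrite lt_neqAle z1n.
have z2l : z.2 < 1 by rewrite lt_neqAle z2n.
(* z is on the left side of a box. A strict corner of any point of the segment up to the next grid
   line would be strict for z as well. *)
have [iE|ine] := eqVneq (grid i) z.1.
  have [k kD [zk kP]] := grid_ceil z2.
  have jk : (j <= k)%N by rewrite -grid_le; exact: le_trans jz zk.
  apply: (use i i j k); rewrite ?leqnn ?iD ?jk //; first by left.
    by rewrite /box /= iE lexx jz zk.
  move=> u [/andP[u1 u1'] /andP[u2 u2']]; apply/boundary_staircaseE; split.
    split; [by apply: le_trans u1' _; rewrite grid_le1| |by exists i, j].
    by apply: le_trans u2' _; rewrite grid_le1.
  case=> _ _ [i' [j' [Pij' iu ju]]]; apply: nz; split=> //; exists i', j'; split=> //.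
    by rewrite -iE; exact: lt_le_trans iu u1'.
  by apply: kP; rewrite ltnNge -grid_le -ltNge; exact: lt_le_trans ju u2'.
have [jE|jne] := eqVneq (grid j) z.2.
  have [k kD [zk kP]] := grid_ceil z1.
  have ik : (i <= k)%N by rewrite -grid_le; exact: le_trans iz zk.
  apply: (use i k j j); rewrite ?leqnn ?jD ?ik //; first by right.
    by rewrite /box /= jE lexx iz zk.
  move=> u [/andP[u1 u1'] /andP[u2 u2']]; apply/boundary_staircaseE; split.
    split; [by apply: le_trans u1' _; rewrite grid_le1| |by exists i, j].
    by apply: le_trans u2' _; rewrite grid_le1.
  case=> _ _ [i' [j' [Pij' iu ju]]]; apply: nz; split=> //; exists i', j'; split=> //.
    by apply: kP; rewrite ltnNge -grid_le -ltNge; exact: lt_le_trans iu u1'.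
  by rewrite -jE; exact: lt_le_trans ju u2'.
(* Off all these sides the corner is strict, which makes z interior. *)
by case: nz; split=> //; exists i, j; rewrite !lt_neqAle ine jne iz jz.
Qed.

End Staircase.

Theorem mainTheorem5 (R : realType) (w : F2) (hw : positive w) (c : rat) :
  let S : set (R * R) :=
    [set z | [/\ 0 <= z.1 <= 1, 0 <= z.2 <= 1
               & ratr c <= max_rot w z.1 z.2]] in
  rational_polygon S /\ rectilinear_boundary S.
Proof.
move=> S; have [D D0 corner] := @max_rot_corner R w c hw.
pose P (i j : nat) := ratr c <= max_rot w (i%:R / D%:R : R) (j%:R / D%:R).
(* One inclusion is the existence of corners, the other the monotonicity of [max_rot]. *)
have -> : S = staircase D P.
  apply/seteqP; split=> z.
    move=> [/andP[z10 z11] /andP[z20 z21] cz]; split=> //.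
    by have [i [j [iz jz Pij]]] := corner _ _ z10 z20 cz; exists i, j.
  move=> [z1 z2 [i [j [Pij iz jz]]]]; split.
  - by rewrite z1 andbT; apply: le_trans iz; rewrite divr_ge0.
  - by rewrite z2 andbT; apply: le_trans jz; rewrite divr_ge0.
  - exact: le_trans Pij (max_rot_le hw iz jz).
by split; [exact: staircase_polygon|exact: staircase_rectilinear].
Qed.
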